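(* The map $\mathbb R\to\{\bullet\}$ from the real line to the one-point space belongs to the class $$\{\mathsf M\to\mathsf\Lambda,\ \ \mathsf\Lambda\to\{\bullet\}\}^{lr}.$$
   Context: The class is computed in the category of all topological spaces and continuous maps. $\mathsf\Lambda=\{a\leftarrow o\to b\}$ is the three-point space with one open point $o$ and two closed points $a,b$ (open sets $\emptyset,\{o\},\{a,o\},\{o,b\},\{a,o,b\}$). $\mathsf M=\{a\leftarrow u\to x\leftarrow v\to b\}$ is the five-point space whose topology is generated by the open sets $\{u\},\{v\},\{a,u\},\{u,x,v\},\{v,b\}$. The map $\mathsf M\to\mathsf\Lambda$ sends $a\mapsto a$, $b\mapsto b$ and $u,x,v\mapsto o$. For maps $f:A\to B$, $g:X\to Y$, $f\pitchfork g$ means: for all $t:A\to X$, $s:B\to Y$ with $g\circ t=s\circ f$ there is $h:B\to X$ with $h\circ f=t$ and $g\circ h=s$. For a class $P$ of maps, $P^l=\{f:\ f\pitchfork g \text{ for all } g\in P\}$, $P^r=\{g:\ f\pitchfork g\text{ for all } f\in P\}$, $P^{lr}=(P^l)^r$. *)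

(* Defs.v *)
From HB Require Import structures.
From mathcomp Require Import all_boot all_order all_algebra finmap.
From mathcomp Require Import all_classical.
From mathcomp Require Import reals topology normedtype.
Export numFieldNormedType.Exports.

Set Implicit Arguments.
Unset Strict Implicit.
Unset Printing Implicit Defensive.

Local Open Scope classical_set_scope.

Inductive Lambda_space := La | Lo | Lb.

HB.instance Definition _ := gen_eqMixin Lambda_space.
HB.instance Definition _ := gen_choiceMixin Lambda_space.

Definition Lambda_open : set (set Lambda_space) :=
  [set set0; [set Lo]; [set La; Lo]; [set Lo; Lb]; [set La; Lo; Lb]].

Lemma Lambda_openE (U : set Lambda_space) :
  Lambda_open U <-> (U !=set0 -> U Lo).
Proof.
split=> [|Uo].
  by case=> [[[[|]|]|]|] -> //=; [case | auto..].
have [U0|/set0P/Uo {}Uo] := eqVneq U set0; first by do 4 left.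
have [Ua|Ua] := pselect (U La); have [Ub|Ub] := pselect (U Lb).
- right; apply/seteqP; split=> -[] //=; intuition congruence.
- left; left; right; apply/seteqP; split=> -[] //=; intuition congruence.
- left; right; apply/seteqP; split=> -[] //=; intuition congruence.
- left; left; left; right; apply/seteqP; split=> -[] //=; intuition congruence.
Qed.

Lemma Lambda_openT : Lambda_open setT.
Proof. exact/Lambda_openE. Qed.

Lemma Lambda_openI : setI_closed Lambda_open.
Proof.
move=> U V /Lambda_openE Uo /Lambda_openE Vo; apply/Lambda_openE.
by move=> [x [Ux Vx]]; split; [apply: Uo | apply: Vo]; exists x.
Qed.

Lemma Lambda_open_bigcup (I : Type) (F : I -> set Lambda_space) :
  (forall i, Lambda_open (F i)) -> Lambda_open (\bigcup_i F i).
Proof.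
move=> Fo; apply/Lambda_openE => -[x [i _ Fix]]; exists i => //.
by have /Lambda_openE := Fo i; apply; exists x.
Qed.

HB.instance Definition _ := isOpenTopological.Build Lambda_space
  Lambda_openT Lambda_openI Lambda_open_bigcup.

Inductive M_space := Ma | Mu | Mx | Mv | Mb.

HB.instance Definition _ := gen_eqMixin M_space.
HB.instance Definition _ := gen_choiceMixin M_space.

Definition M_subbase : set (set M_space) :=
  [set [set Mu]; [set Mv]; [set Ma; Mu]; [set Mu; Mx; Mv]; [set Mv; Mb]].

HB.instance Definition _ :=
  isSubBaseTopological.Build M_space M_subbase id.

HB.instance Definition _ := isOpenTopological.Build unit
  (op := setT) I (fun _ _ _ _ => I) (fun _ _ _ => I).

Definition M_to_Lambda (p : M_space) : Lambda_space :=
  match p with Ma => La | Mb => Lb | _ => Lo end.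

Lemma M_subbase_open (U : set M_space) : M_subbase U -> open U.
Proof.
move=> DU; exists [set U]; last by rewrite bigcup_set1.
move=> _ ->; exists [fset U]%fset.
  by move=> V /fset1P ->; rewrite inE.
apply/seteqP; split=> [x /(_ U)|x Ux V /fset1P ->//]; apply.
by apply/fset1P.
Qed.

Lemma M_to_Lambda_continuous : continuous M_to_Lambda.
Proof.
apply/continuousP => U.
have Eo : M_to_Lambda @^-1` [set Lo] = [set Mu; Mx; Mv].
  by apply/seteqP; split=> -[] //=; intuition congruence.
have oo : open [set Mu; Mx; Mv] by apply: M_subbase_open; left; right.
have oa : open [set Ma; Mu] by apply: M_subbase_open; left; left; right.
have ob : open [set Mv; Mb] by apply: M_subbase_open; right.
have Ea : M_to_Lambda @^-1` [set La; Lo] = [set Ma; Mu] `|` [set Mu; Mx; Mv].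
  by apply/seteqP; split=> -[] //=; intuition congruence.
have Eb : M_to_Lambda @^-1` [set Lo; Lb] = [set Mu; Mx; Mv] `|` [set Mv; Mb].
  by apply/seteqP; split=> -[] //=; intuition congruence.
have Et : M_to_Lambda @^-1` [set La; Lo; Lb] = setT.
  by apply/seteqP; split=> -[] //=; intuition congruence.
case=> [[[[|]|]|]|] ->.
- by rewrite preimage_set0; exact: open0.
- by rewrite Eo.
- by rewrite Ea; exact: openU.
- by rewrite Eb; exact: openU.
- by rewrite Et; exact: openT.
Qed.

HB.instance Definition _ := isContinuous.Build M_space Lambda_space
  M_to_Lambda M_to_Lambda_continuous.

(* A topologicalType carries a choice structure; by classical choice every
   topological space, empty or not, underlies some topologicalType. *)
Definition map_class :=
  forall X Y : topologicalType, set (continuousType X Y).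

Definition lifts (A B X Y : topologicalType)
    (f : continuousType A B) (g : continuousType X Y) : Prop :=
  forall (t : continuousType A X) (s : continuousType B Y),
    g \o t = s \o f ->
    exists h : continuousType B X, h \o f = t /\ g \o h = s.

Definition left_orthogonal (P : map_class) : map_class :=
  fun A B f => forall (X Y : topologicalType) (g : continuousType X Y),
    P X Y g -> lifts f g.

Definition right_orthogonal (P : map_class) : map_class :=
  fun X Y g => forall (A B : topologicalType) (f : continuousType A B),
    P A B f -> lifts f g.

Definition to_point (X : topologicalType) : continuousType X unit := cst tt.

Inductive M_Lambda_class : map_class :=
  | M_Lambda_class_proj : @M_Lambda_class M_space Lambda_space M_to_Lambda
  | M_Lambda_class_point :
      @M_Lambda_class Lambda_space unit (to_point Lambda_space).

(* Main.v *)
(* Lifting against M -> Lambda says that disjoint open sets of A extend to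
   disjoint open sets of B, enlarging any prescribed disjoint closed sets of B
   whose preimages they contain.  This is exactly what one step of Urysohn's
   construction needs, so a map t : A -> [0, 1] extends to B by building, for
   each dyadic r, sets W_r <= K_r in B (W_r open, K_r closed) that restrict to
   {t < r} and {t <= r}, with K_r <= W_r' for r < r'.  For t : A -> R, compress
   R to ]0, 1[, extend, and multiply by a second extension (of the constant 1)
   that vanishes where the first one reaches an endpoint. *)
Require Import Defs.
From mathcomp Require Import all_boot all_order all_algebra.
From mathcomp Require Import all_classical.
From mathcomp Require Import reals topology normedtype.
From mathcomp Require Import finmap ring lra.

Set Implicit Arguments.
Unset Strict Implicit.
Unset Printing Implicit Defensive.

Import Order.TTheory GRing.Theory Num.Theory.
Local Open Scope classical_set_scope.
Local Open Scope ring_scope.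

(** * Maps into the two finite spaces, and the separation property *)

Lemma continuous_to_M (T : topologicalType) (p : T -> M_space) :
  (forall U, M_subbase U -> open (p @^-1` U)) -> continuous p.
Proof.
move=> subo; apply/continuousP => _ [D' D'D <-].
rewrite preimage_bigcup; apply: bigcup_open => _ /D'D [D DM <-].
rewrite openE => y py; apply: filter_bigI => /= V VD.
apply: open_nbhs_nbhs; split; last exact: py.
by apply: subo; apply/set_mem/DM.
Qed.

Lemma continuous_to_Lambda (T : topologicalType) (s : T -> Lambda_space) :
  closed (s @^-1` [set La]) -> closed (s @^-1` [set Lb]) -> continuous s.
Proof.
move=> ca cb.
have ao : open (s @^-1` [set La; Lo]).
  rewrite (_ : _ @^-1` _ = ~` (s @^-1` [set Lb])); first exact: closed_openC.
  by apply/seteqP; split=> y /=; case: (s y) => //; intuition congruence.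
have ob : open (s @^-1` [set Lo; Lb]).
  rewrite (_ : _ @^-1` _ = ~` (s @^-1` [set La])); first exact: closed_openC.
  by apply/seteqP; split=> y /=; case: (s y) => //; intuition congruence.
apply/continuousP => U [[[[|]|]|]|] ->.
- by rewrite preimage_set0; exact: open0.
- rewrite (_ : _ @^-1` _ = s @^-1` [set La; Lo] `&` s @^-1` [set Lo; Lb]).
    exact: openI.
  by apply/seteqP; split=> y /=; case: (s y) => //; intuition congruence.
- exact: ao.
- exact: ob.
- rewrite (_ : _ @^-1` _ = setT); first exact: openT.
  by apply/seteqP; split=> y //=; case: (s y) => //; intuition congruence.
Qed.

Definition extends_separations (A B : topologicalType) (f : A -> B) :=
  forall (F G : set B) (U V : set A),
    closed F -> closed G -> F `&` G = set0 ->
    open U -> open V -> U `&` V = set0 ->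
    f @^-1` F `<=` U -> f @^-1` G `<=` V ->
  exists U' V' : set B,
    [/\ [/\ open U', open V' & U' `&` V' = set0],
      F `<=` U', G `<=` V', f @^-1` U' = U & f @^-1` V' = V].

(* A map to M is a pair of disjoint open sets, the preimages of {a,u} and
   {v,b}, with a closed subset of each, the preimages of a and b. *)
Lemma lifts_M_extends_separations (A B : topologicalType)
    (f : continuousType A B) :
  lifts f M_to_Lambda -> extends_separations f.
Proof.
move=> lif F G U V cF cG FG oU oV UV FU GV.
have FGy y : F y -> G y -> False by rewrite -[False]/(set0 y) -FG.
have UVa a : U a -> V a -> False by rewrite -[False]/(set0 a) -UV.
pose s y := if `[< F y >] then La else if `[< G y >] then Lb else Lo.
have sc : continuous s.
  apply: continuous_to_Lambda.
    rewrite (_ : _ @^-1` _ = F)//; apply/seteqP; split=> y /=;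
      rewrite /s; do 2?[case: asboolP => ?]; intuition congruence.
  rewrite (_ : _ @^-1` _ = G)//; apply/seteqP; split=> y /=;
    have := FGy y; rewrite /s; do 2?[case: asboolP => ?]; intuition congruence.
(* Testing [F] and [G] first makes the square with [s] commute; the rest of [U] and [V] goes to [Mu]
   and [Mv], everything else to [Mx]. *)
pose t a := if `[< F (f a) >] then Ma else if `[< G (f a) >] then Mb else
  if `[< U a >] then Mu else if `[< V a >] then Mv else Mx.
have fo D : closed D -> open (~` (f @^-1` D)).
  move=> /closed_openC; exact: (proj1 (continuousP f) (@cts_fun _ _ f) (~` D)).
pose tE a := (FU a, GV a, UVa a).
have tU : t @^-1` [set Ma; Mu] = U.
  apply/seteqP; split=> a /=; have := tE a; rewrite /t /=;
    do 4?[case: asboolP => ?]; intuition congruence.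
have tV : t @^-1` [set Mv; Mb] = V.
  apply/seteqP; split=> a /=; have := tE a; rewrite /t /=;
    do 4?[case: asboolP => ?]; intuition congruence.
have tc : continuous t.
  apply: continuous_to_M => W [[[[|]|]|]|] ->.
  - rewrite (_ : _ @^-1` _ = U `&` ~` (f @^-1` F)).
      by apply: openI => //; exact: fo.
    rewrite -tU; apply/seteqP; split=> a /=; rewrite /t;
      do 4?[case: asboolP => ?]; intuition congruence.
  - rewrite (_ : _ @^-1` _ = V `&` ~` (f @^-1` G)).
      by apply: openI => //; exact: fo.
    apply/seteqP; split=> a /=; have := tE a; rewrite /t /=;
      do 4?[case: asboolP => ?]; intuition congruence.
  - by rewrite tU.
  - rewrite (_ : _ @^-1` _ = ~` (f @^-1` F) `&` ~` (f @^-1` G)).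
      by apply: openI; exact: fo.
    apply/seteqP; split=> a /=; rewrite /t;
      do 4?[case: asboolP => ?]; intuition congruence.
  - by rewrite tV.
have [|h [ht hs]] := lif (mkcts tc) (mkcts sc).
  apply/funext => a; rewrite -[LHS]/(M_to_Lambda (t a)) -[RHS]/(s (f a)) /t /s.
  by do 4?[case: asboolP => ?].
have hsE y : M_to_Lambda (h y) = s y by rewrite -[LHS]/((M_to_Lambda \o h) y) hs.
have hc : continuous h by exact: cts_fun.
exists (h @^-1` [set Ma; Mu]), (h @^-1` [set Mv; Mb]); split.
- split.
  + by apply: (proj1 (continuousP _) hc); apply: M_subbase_open; left; left; right.
  + by apply: (proj1 (continuousP _) hc); apply: M_subbase_open; right.
  + by apply/seteqP; split=> y //= -[[]->[]].
(* The fibre of [M_to_Lambda] over [La] is the single point [Ma], so [h] sends [F] to [Ma]; likewise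
   [G] to [Mb]. *)
- move=> y Fy /=; have := hsE y; rewrite /s.
  by case: asboolP => // _; case: (h y) => //= _; left.
- move=> y Gy /=; have := hsE y; rewrite /s.
  case: asboolP => [/FGy/(_ Gy)//|_].
  by case: asboolP => // _; case: (h y) => //= _; right.
- by rewrite -comp_preimage ht.
- by rewrite -comp_preimage ht.
Qed.

(** * Dyadic numbers, and the function defined by a dyadic family of sets *)

Lemma dyadic_dense (R : realType) (a b : R) : 0 <= a -> a < b ->
  exists n k : nat, a < k%:R / 2 ^+ n < b.
Proof.
move=> a0 ab; have ba0 : 0 < b - a by lra.
(* The mesh [1 / 2 ^+ n] is below [b - a]; the numerator is the first integer beyond
   [a * 2 ^+ n]. *)
pose n := Num.bound (b - a)^-1; exists n, (Num.truncn (a * 2 ^+ n)).+1.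
have n0 : 0 < 2 ^+ n :> R by rewrite exprn_gt0.
have : (b - a)^-1 < 2 ^+ n by exact: upper_nthrootP.
rewrite invf_plt ?posrE// => n1.
have /truncn_itv/andP[le1 lt1] : 0 <= a * 2 ^+ n by rewrite mulr_ge0// ltW.
rewrite ltr_pdivlMr// lt1 ltr_pdivrMr//= -natr1.
have : 1 < (b - a) * 2 ^+ n by rewrite -ltr_pdivrMr// div1r.
lra.
Qed.

Section dyadic_filtration.
Context (R : realType) (T : topologicalType) (W K : nat -> nat -> set T).
Hypothesis Wo : forall n k, open (W n k).
Hypothesis Kc : forall n k, closed (K n k).
Hypothesis WK : forall n k, W n k `<=` K n k.
Hypothesis KW : forall n k, K n k `<=` W n k.+1.
Hypothesis W2 : forall n k, W n.+1 k.*2 = W n k.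
Hypothesis K2 : forall n k, K n.+1 k.*2 = K n k.
Hypothesis W01 : W 0 1 = setT.

Let refineW m n k : W (m + n) (k * 2 ^ m) = W n k.
Proof.
elim: m => [|m IHm]; first by rewrite muln1.
by rewrite addSn expnS mulnCA mul2n W2 IHm.
Qed.

Let refineK m n k : K (m + n) (k * 2 ^ m) = K n k.
Proof.
elim: m => [|m IHm]; first by rewrite muln1.
by rewrite addSn expnS mulnCA mul2n K2 IHm.
Qed.

(** By [W2] and [K2] the sets depend only on the number [k / 2 ^ n]. Over the common denominator
    [2 ^ (n + n')], the inclusions [KW] and [WK] alternate up from one numerator to the other. *)
Let K_sub_W n k n' k' : k%:R / 2 ^+ n < k'%:R / 2 ^+ n' :> R ->
  K n k `<=` W n' k'.
Proof.
rewrite ltr_pdivlMr ?exprn_gt0// mulrAC ltr_pdivrMr ?exprn_gt0//.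
rewrite -!natrX -!natrM ltr_nat => lt_kk'.
rewrite -(refineK n') -(refineW n) (addnC n).
elim: (k' * _)%N lt_kk' => // j IHj; rewrite ltnS leq_eqVlt => /predU1P[->|/IHj sub].
  exact: KW.
by apply: subset_trans sub _; apply: subset_trans (@KW _ _); exact: WK.
Qed.

(** Take for [h y] the infimum of the dyadics whose [W] contains [y]. Openness of [W] bounds [h]
    from above near a point, closedness of [K] from below. *)
Lemma dyadic_filtration_function : exists h : T -> R,
  [/\ continuous h,
      forall y, 0 <= h y,
      forall n k y, W n k y -> h y <= k%:R / 2 ^+ n &
      forall n k y, h y < k%:R / 2 ^+ n -> W n k y].
Proof.
pose D y : set R := [set x | exists n k, W n k y /\ x = k%:R / 2 ^+ n].
(* [W01] puts 1 in every [D y], so no infimum is taken over the empty set. *)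
have D0 y : D y !=set0 by exists (1%:R / 2 ^+ 0), 0%N, 1%N; rewrite W01.
have Dlb y : lbound (D y) 0 by move=> _ [n [k [_ ->]]]; rewrite divr_ge0 ?exprn_ge0.
pose h y := inf (D y); exists h.
have h0 y : 0 <= h y by exact: lb_le_inf.
have hle n k y : W n k y -> h y <= k%:R / 2 ^+ n.
  by move=> Wy; apply: ge_inf; [exists 0|exists n, k].
have hlt n k y : h y < k%:R / 2 ^+ n -> W n k y.
  by move=> /(inf_lt (D0 y))[_ [n' [k' [/WK Ky ->]]] /K_sub_W]; exact.
split=> // y; apply/cvgrPdist_lt => e e0.
have ylt : \forall z \near y, h z < h y + e.
  have [|n [k /andP[lo hi]]] := dyadic_dense (h0 y) (b := h y + e).
    by rewrite ltrDl.
  near=> z; apply: le_lt_trans hi; apply: hle; near: z.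
  by apply: open_nbhs_nbhs; split; [exact: Wo|exact: hlt].
have ygt : \forall z \near y, h y - e < h z.
  have [hye|hye] := ltP (h y - e) 0.
    by apply: nearW => z; apply: lt_le_trans hye _.
  have [|n [k /andP[lo hi]]] := dyadic_dense hye (b := h y).
    by rewrite ltrBlDr ltrDl.
  (* A second dyadic is chosen below [h y]: if [y] were in [K n k], it would be in the [W] of that
     dyadic, which would then bound [h y]. *)
  have Ky : ~ K n k y.
    have k0 : 0 <= k%:R / 2 ^+ n :> R by rewrite divr_ge0 ?exprn_ge0.
    have [n' [k' /andP[lo' hi']]] := dyadic_dense k0 hi.
    by move=> /(K_sub_W lo')/hle; rewrite leNgt hi'.
  near=> z; apply: lt_le_trans lo _; rewrite leNgt; apply/negP => /hlt/WK.
  by near: z; apply: open_nbhs_nbhs; split; [exact: closed_openC|].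
near=> z; rewrite ltr_distlC.
by apply/andP; split; near: z.
Unshelve. all: by end_near.
Qed.

End dyadic_filtration.

(** * Extending continuous real functions along [f] *)

Section extension.
Context (R : realType) (A B : topologicalType) (f : A -> B).
Hypothesis fsep : extends_separations f.

(* [p.1] and [p.2] will sandwich the sublevel sets [{h < r}] and [{h <= r}]
   of an extension [h] of [t] along [f]. *)
Definition is_cut (t : A -> R) (r : R) (p : set B * set B) :=
  [/\ open p.1, closed p.2, p.1 `<=` p.2,
      forall a, t a < r -> p.1 (f a) & forall a, p.2 (f a) -> t a <= r].

(** Separate [p.2] from the complement of [q.1], extending [{t < s}] and [{s < t}] to disjoint open
    [U] and [V]; the new cut is [U] with the complement of [V]. *)
Lemma cut_between (t : A -> R) (r s r' : R) (p q : set B * set B) :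
  continuous t -> r < s < r' -> is_cut t r p -> is_cut t r' q ->
  p.2 `<=` q.1 ->
  exists c, [/\ is_cut t s c, p.2 `<=` c.1 & c.2 `<=` q.1].
Proof.
move=> tc /andP[rs sr'] [_ cp _ _ pt] [oq _ _ qt _] pq.
have /continuousP to := tc.
have [||||||||U [V [[oU oV UV] pU qV Us Vs]]] :=
    @fsep p.2 (~` q.1) [set a | t a < s] [set a | s < t a].
- exact: cp.
- exact: open_closedC.
- by apply/disjoints_subset; rewrite setCK.
- exact: (to [set x | x < s] (@open_lt _ _)).
- exact: (to [set x | s < x] (@open_gt _ _)).
- by apply/seteqP; split=> a //= -[/lt_trans/[apply]]; rewrite ltxx.
- by move=> a /pt /le_lt_trans; exact.
- move=> a /= qa; rewrite ltNge; apply/negP => /le_lt_trans/(_ sr')/qt.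
  exact: qa.
exists (U, ~` V); split => //=; last first.
  by move=> y /=; apply: contra_notP; exact: qV.
split=> //=.
- exact: open_closedC.
- by rewrite -disjoints_subset.
- by move=> a tas; rewrite -[U _]/((f @^-1` U) a) Us.
- move=> a; rewrite -[V _]/((f @^-1` V) a) Vs /= => /negP.
  by rewrite -leNgt.
Qed.

(** The set [F], which misses the image of [f], enters as the closed half of the cut at 0; this
    forces the extension to vanish on it. *)
Lemma extension_unit_interval (t : A -> R) (F : set B) :
  continuous t -> (forall a, 0 <= t a <= 1) ->
  closed F -> f @^-1` F = set0 ->
  exists h : B -> R, [/\ continuous h, forall a, h (f a) = t a,
    forall y, 0 <= h y <= 1 & forall y, F y -> h y = 0].
Proof.
move=> tc t01 cF F0.
pose P := (set B * set B)%type.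
(* The premises of [cut_between] sit inside [btw], so that choice yields a total [g]. *)
pose btw (x : P * P * (R * R * R)) (c : P) :=
  let: (p, q, (r, s, r')) := x in
  r < s < r' -> is_cut t r p -> is_cut t r' q -> p.2 `<=` q.1 ->
  [/\ is_cut t s c, p.2 `<=` c.1 & c.2 `<=` q.1].
have /choice[g gP] : forall x, exists c, btw x c.
  move=> [[p q] [[r s] r']].
  have [[rs [cp [cq pq]]]|no] := pselect
      (r < s < r' /\ is_cut t r p /\ is_cut t r' q /\ p.2 `<=` q.1).
    by have [c ?] := cut_between tc rs cp cq pq; exists c.
  by exists p => rs cp cq pq; case: no.
pose d n k : R := k%:R / 2 ^+ n.
(* [L n k] is the cut at [k / 2 ^ n]: even indices copy the previous level, odd ones interpolate
   between two neighbours there. *)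
pose fix L (n k : nat) {struct n} : P := match n with
  | 0 => if k is 0 then (set0, F) else (setT, setT)
  | n'.+1 => if odd k
      then g (L n' k./2, L n' k./2.+1, (d n' k./2, d n'.+1 k, d n' k./2.+1))
      else L n' k./2
  end.
have d2 n k : d n.+1 k.*2 = d n k.
  rewrite /d -muln2 natrM exprS invfM.
  by rewrite -mulrA mulVKf// pnatr_eq0.
have d_lt n k k' : (k < k')%N -> d n k < d n k'.
  by move=> kk'; rewrite ltr_pM2r ?invr_gt0 ?exprn_gt0// ltr_nat.
(* Nesting is proved together with the cut property: [g] needs both at the next level. *)
have LP n k : is_cut t (d n k) (L n k) /\ (L n k).2 `<=` (L n k.+1).1.
  elim: n k => [|n IHn] k.
    case: k => [|k] /=; split=> //; split=> //=.
    - exact: open0.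
    - by move=> a; rewrite /d mul0r ltNge; case/andP: (t01 a) => ->.
    - by move=> a; rewrite -[F _]/((f @^-1` F) a) F0.
    - exact: openT.
    - move=> a _; apply: (@le_trans _ _ 1); first by case/andP: (t01 a).
      by rewrite /d expr0 divr1 ler1n.
  have odd_step j : [/\ is_cut t (d n.+1 j.*2.+1) (L n.+1 j.*2.+1),
      (L n j).2 `<=` (L n.+1 j.*2.+1).1 &
      (L n.+1 j.*2.+1).2 `<=` (L n j.+1).1].
    have [Lj Lsub] := IHn j; have [Lj1 _] := IHn j.+1.
    rewrite [L n.+1 _]/= odd_double /= uphalf_double.
    apply: (gP (_, _, (_, _, _))) => //.
    by rewrite -d2 -(d2 n j.+1) !d_lt// doubleS.
  have evenE j : L n.+1 j.*2 = L n j by rewrite /= odd_double doubleK.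
  rewrite -(odd_double_half k); case: (odd k); rewrite ?add1n ?add0n.
    rewrite -doubleS (evenE _.+1).
    by have [? _ ?] := odd_step k./2.
  rewrite (evenE k./2) d2.
  by have [_ ? _] := odd_step k./2; split=> //; case: (IHn k./2).
have [|||||||h [hc h0 hle hlt]] := @dyadic_filtration_function R B
    (fun n k => (L n k).1) (fun n k => (L n k).2).
- by move=> n k; have [[]] := LP n k.
- by move=> n k; have [[]] := LP n k.
- by move=> n k; have [[]] := LP n k.
- by move=> n k; have [] := LP n k.
- by move=> n k /=; rewrite odd_double doubleK.
- by move=> n k /=; rewrite odd_double doubleK.
- by [].
have Fsub n y : F y -> (L n 1%N).1 y.
  have L0 : L n 0%N = (set0, F) by elim: n.
  by have [_] := LP n 0%N; rewrite L0; exact.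
exists h; split=> //.
(* A dyadic strictly between [t a] and [h (f a)], in either order, contradicts the cut at that
   dyadic. *)
- move=> a; apply/eqP; rewrite eq_le !leNgt; apply/andP; split; apply/negP.
    have /andP[t0 _] := t01 a.
    move=> /(dyadic_dense t0)[n [k /andP[lo hi]]].
    have [[_ _ _ /(_ a lo)/hle + _] _] := LP n k.
    by rewrite leNgt hi.
  move=> /(dyadic_dense (h0 _))[n [k /andP[/hlt lo hi]]].
  have [[_ _ sub _ tle] _] := LP n k.
  by have := lt_le_trans hi (tle a (sub _ lo)); rewrite ltxx.
- by move=> y; rewrite h0/=; have := hle 0%N 1%N y I; rewrite expr0 divr1.
(* A dyadic [k / 2 ^ n] in []0, h y[] has [k >= 1], whereas [Fsub] gives [h y <= 1 / 2 ^ n]. *)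
- move=> y Fy; apply/eqP; rewrite eq_le h0 andbT leNgt; apply/negP.
  move=> /(dyadic_dense (lexx _))[n [k /andP[lo hi]]].
  have := hle _ _ _ (Fsub n y Fy); rewrite leNgt => /negP; apply.
  apply: le_lt_trans hi; rewrite ler_pM2r ?invr_gt0 ?exprn_gt0// ler_nat.
  by rewrite lt0n; apply: contraTneq lo => ->; rewrite mul0r ltxx.
Qed.

Lemma extension_real (t : A -> R) : continuous t ->
  exists h : B -> R, continuous h /\ h \o f = t.
Proof.
move=> tc.
have nc (T : topologicalType) (u : T -> R) : continuous u ->
    continuous (fun x => `|u x|).
  by move=> uc x; apply: continuous_comp; [exact: uc|exact: norm_continuous].
have dc (T : topologicalType) (u v : T -> R) : continuous u -> continuous v ->
    (forall x, v x != 0) -> continuous (fun x => u x / v x).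
  by move=> uc vc v0 x; apply: cvgM; [exact: uc|apply: cvgV; [|exact: vc]].
have pos (x : R) : 0 < 1 + `|x| by rewrite ltr_pwDl.
(* The homeomorphism [x / (1 + |x|)] onto []-1, 1[], rescaled to []0, 1[]; its inverse
   [y / (1 - |y|)] gives the final extension. *)
pose t1 a := (1 + t a / (1 + `|t a|)) / 2.
have t1c : continuous t1.
  apply: (dc); [|by move=> ?; exact: cvg_cst|by move=> _; rewrite pnatr_eq0].
  have qc : continuous (fun a => t a / (1 + `|t a|)).
    apply: (dc) => // [x|x]; last by rewrite gt_eqF.
    by apply: cvgD; [exact: cvg_cst|exact: nc].
  by move=> a; apply: cvgD; [exact: cvg_cst|exact: qc].
have t1_01 a : 0 < t1 a < 1.
  have : `|t a / (1 + `|t a|)| < 1.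
    by rewrite normrM normfV (gtr0_norm (pos _)) ltr_pdivrMr// mul1r ltrDr.
  by rewrite /t1 ltr_norml => /andP[? ?]; apply/andP; split; lra.
have [|||h [hc ht h01 _]] := @extension_unit_interval t1 set0 t1c.
- by move=> a; have /andP[/ltW -> /ltW ->] := t1_01 a.
- exact: closed0.
- exact: preimage_set0.
(* [h] may reach the values 0 and 1 outside the image of [f]: the factor [k]
   below cuts it off there without changing it on the image. *)
pose Z := h @^-1` [set 0; 1].
have [||||k [kc k1 k01 kZ]] := @extension_unit_interval (cst 1) Z.
- by move=> ?; exact: cvg_cst.
- by move=> a; rewrite ler01 lexx.
- apply: preimage_closed; first by move=> ? _; exact: hc.
  by apply: closedU; exact: closed_eq.
- apply/seteqP; split=> a //; rewrite /Z /= ht; have /andP[gt0 lt1] := t1_01 a.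
  by case=> t1a; move: gt0 lt1; rewrite t1a ltxx.
pose g y := (h y * 2 - 1) * k y.
have gc : continuous g.
  move=> y; apply: cvgM; last exact: kc.
  apply: cvgB; last exact: cvg_cst.
  by apply: cvgM; [exact: hc|exact: cvg_cst].
(* On [Z] the factor [k] is 0; off [Z], [0 < h < 1] gives [|2h - 1| < 1], and [0 <= k <= 1]. *)
have g1 y : 0 < 1 - `|g y|.
  rewrite subr_gt0; have /andP[k0 k1'] := k01 y; have /andP[h0 h1] := h01 y.
  have [/kZ k0'|nZ] := pselect (Z y); first by rewrite /g k0' mulr0 normr0.
  have hn0 : h y != 0 by apply/eqP => h0'; apply: nZ; left.
  have hn1 : h y != 1 by apply/eqP => h0'; apply: nZ; right.
  have {hn0}h0 : 0 < h y by rewrite lt_neqAle eq_sym hn0.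
  have {hn1}h1 : h y < 1 by rewrite lt_neqAle hn1.
  rewrite normrM; apply: (@le_lt_trans _ _ (`|h y * 2 - 1|)).
    by rewrite ler_piMr// ger0_norm.
  by rewrite ltr_norml; apply/andP; split; lra.
exists (fun y => g y / (1 - `|g y|)); split.
  apply: (dc) => // [y|y]; last by rewrite gt_eqF.
  by apply: cvgB; [exact: cvg_cst|exact: nc].
apply/funext => a /=.
have -> : g (f a) = t a / (1 + `|t a|).
  by rewrite /g ht k1 /t1 /cst/=; lra.
rewrite normrM normfV (gtr0_norm (pos _)).
have := pos (t a); move: (`|t a|) => u u0.
by field; rewrite addrK oner_neq0 gt_eqF.
Qed.

End extension.

Theorem corollary3p13 (R : realType) :
  right_orthogonal (left_orthogonal M_Lambda_class) (to_point R).
Proof.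
move=> A B f /(_ _ _ _ M_Lambda_class_proj) fM t s _.
have [h [hc hf]] :=
  extension_real (lifts_M_extends_separations fM) (@cts_fun _ _ t).
exists (mkcts hc); split=> //.
by apply/funext => y; case: (s y).
Qed.
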